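(* Let $n\in\mathbb{N}$ and let $I$ be an interval of the Tamari lattice $\mathrm{Tam}_n$. Then there is an interval $[\pi_1,\pi_2]$ of the lattice $\mathrm{NC}_n$ of noncrossing partitions such that $I=[T_{\pi_1},T_{\pi_2}]$ if and only if the interval-poset corresponding to $I$ is exceptional.
   Context: **Binary trees and the Tamari lattice.** A (planar) binary tree of size $n$ is a rooted planar tree with $n$ inner vertices, each having a left child and a right child (each child is an inner vertex or a leaf); it has $n+1$ leaves. ''Vertex'' means inner vertex; the left (right) son of a vertex is its left (right) child when this is an inner vertex. Write $X\wedge Z$ for the tree whose root has left subtree $X$ and right subtree $Z$. $\mathrm{Tam}_n$ is the set of binary trees of size $n$, ordered by the reflexive transitive closure of the covering relation in which a tree is covered by any tree obtained from it by replacing one subtree of the form $(A\wedge B)\wedge C$ by $A\wedge(B\wedge C)$. The vertices of a tree $S$ of size $n$ are labelled $1,\dots,n$ in in-order (recursively: left subtree, root, right subtree), and $i\lhd_S j$ means that vertex $i$ lies in the subtree rooted at vertex $j$ (including $i=j$). **Interval-posets.** An interval-poset of size $n$ is a (reflexive) partial order $\lhd$ on $\{1,\dots,n\}$ such that for all $a<b<c$: $a\lhd c$ implies $b\lhd c$, and $c\lhd a$ implies $b\lhd a$. For $a<b$, a relation $a\lhd b$ is called increasing and a relation $b\lhd a$ decreasing. The interval-poset corresponding to an interval $[S,T]$ of $\mathrm{Tam}_n$ is the reflexive relation whose decreasing relations are those of $\lhd_S$ and whose increasing relations are those of $\lhd_T$; this is a (known) bijection between intervals of $\mathrm{Tam}_n$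 and interval-posets of size $n$. An interval-poset is exceptional if its Hasse diagram contains no $x<y<z$ such that both $y\lhd x$ and $y\lhd z$ are cover relations. **Noncrossing partitions.** A partition of $\{1,\dots,n\}$ is noncrossing if there are no $i<j<k<l$ with $i,k$ in one block and $j,l$ in another block. $\mathrm{NC}_n$ is the set of noncrossing partitions, ordered by refinement: $\pi_1\le\pi_2$ if every block of $\pi_1$ is contained in a block of $\pi_2$. **The tree $T_\pi$.** For $\pi\in\mathrm{NC}_n$, the binary tree $T_\pi$ with vertices $1,\dots,n$ is constructed as follows. (1) To each block $b$ associate the tree with root $\min(b)$ in which, whenever $y$ is the successor of $x$ in $b$ (for the order of integers), $y$ is the right son of $x$. (2) For each block $b$ with maximum $m<n$, graft the root $\min(b)$ of its tree as the left son of the vertex $m+1$. The labels of $T_\pi$ are its in-order labels. *)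

(* Defs.v *)
From Stdlib Require Import Relation_Operators.
From mathcomp Require Import all_boot.

Set Implicit Arguments.
Unset Strict Implicit.
Unset Printing Implicit Defensive.

(* Labels run over 0, ..., n-1 (over 'I_n when the size n is fixed) instead of
   1, ..., n. *)

Inductive bintree := Leaf | Node of bintree & bintree.

(* The number of inner vertices. *)
Fixpoint bsize (S : bintree) : nat :=
  if S is Node l r then (bsize l + bsize r).+1 else 0.

Inductive tam_cover : bintree -> bintree -> Prop :=
| TamRotation A B C :
    tam_cover (Node (Node A B) C) (Node A (Node B C))
| TamLeft l l' r : tam_cover l l' -> tam_cover (Node l r) (Node l' r)
| TamRight l r r' : tam_cover r r' -> tam_cover (Node l r) (Node l r').

(* The order of Tam_n, for all n at once: covers preserve the size. *)
Definition tam_le : bintree -> bintree -> Prop :=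
  clos_refl_trans bintree tam_cover.

Lemma bsize_tam_le S T : tam_le S T -> bsize S = bsize T.
Proof.
elim=> [{}S {}T cST|//|A B C _ -> _ ->//].
elim: cST => [A B C|l l' r _|l r r' _] /=; [|by move=> ->|by move=> ->].
by rewrite addSn addnS addnA.
Qed.

Definition tam_interval (S T X : bintree) : Prop := tam_le S X /\ tam_le X T.

(* [lhd S i j]: the vertex with in-order label i lies in the subtree rooted at
   the vertex with in-order label j.  The root of [Node l r] has label
   [bsize l]. *)
Fixpoint lhd (S : bintree) (i j : nat) : bool :=
  if S is Node l r then
    let k := bsize l in
    if j < k then lhd l i j
    else if j == k then i < bsize S
    else (k < i) && lhd r (i - k.+1) (j - k.+1)
  else false.

Definition interval_poset (n : nat) (S T : bintree) : rel 'I_n :=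
  fun i j => [|| i == j, (j < i) && lhd S i j | (i < j) && lhd T i j].

Definition covered_by (V : finType) (r : rel V) (x y : V) : bool :=
  [&& x != y, r x y & ~~ [exists z, [&& z != x, z != y, r x z & r z y]]].

Definition exceptional (n : nat) (r : rel 'I_n) : Prop :=
  ~ exists x y z : 'I_n,
      [/\ x < y, y < z, covered_by r y x & covered_by r y z].

Definition noncrossing (n : nat) (pi : {set {set 'I_n}}) : Prop :=
  ~ exists (b b' : {set 'I_n}) (i j k l : 'I_n),
      [/\ b \in pi, b' \in pi & b != b'] /\ [/\ i < j, j < k & k < l] /\
      [/\ i \in b, k \in b, j \in b' & l \in b'].

Definition NC (n : nat) (pi : {set {set 'I_n}}) : Prop :=
  partition pi [set: 'I_n] /\ noncrossing pi.

Definition nc_le (n : nat) (pi1 pi2 : {set {set 'I_n}}) : Prop :=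
  forall b, b \in pi1 -> exists2 b', b' \in pi2 & b \subset b'.

(* The tree of a block b: its root is min(b), right sons are successors in b
   (enum b is increasing), and [left x] is grafted as left subtree of x. *)
Definition block_tree (n : nat) (left : 'I_n -> bintree) (b : {set 'I_n}) :
    bintree :=
  foldr (fun x t => Node (left x) t) Leaf (enum b).

(* The tree of the block whose maximum is m - 1, with all grafts performed in
   it, or Leaf if there is no such block.  It is the left subtree of the vertex
   m when m < n, and the whole tree when m = n.  Elements of this block are
   smaller than m, so that any fuel k >= m gives the same result, as
   [graft_fuel] shows. *)
Fixpoint graft (n : nat) (pi : {set {set 'I_n}}) (k m : nat) : bintree :=
  if k is k'.+1 then
    if [pick b in pi | \max_(y in b) y.+1 == m] is Some b
    then block_tree (fun x => graft pi k' x) b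
    else Leaf
  else Leaf.

Definition nc_tree (n : nat) (pi : {set {set 'I_n}}) : bintree := graft pi n n.

Lemma graft_fuel (n : nat) (pi : {set {set 'I_n}}) (k m : nat) :
  set0 \notin pi -> m <= k -> graft pi k m = graft pi m m.
Proof.
move=> pi0; elim/ltn_ind: m k => m IH [|k]; first by rewrite leqn0 => /eqP ->.
case: m IH => [|m] IH le_mk /=.
  case: pickP => // b /andP[bpi /eqP max0].
  case: (set_0Vmem b) => [b0|[y yb]]; first by rewrite -b0 bpi in pi0.
  by have := leq_bigmax_cond (F := fun y : 'I_n => y.+1) y yb; rewrite max0.
case: pickP => // b /andP[bpi /eqP maxb]; rewrite /block_tree.
have : all (fun x : 'I_n => x <= m) (enum b).
  apply/allP=> x; rewrite mem_enum => xb; rewrite -ltnS -maxb.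
  exact: (leq_bigmax_cond (F := fun y : 'I_n => y.+1) x xb).
elim: (enum b) => //= x s IHs /andP[xm /IHs ->].
by rewrite (IH x) ?ltnS // ?(IH x xm m) // (leq_trans xm).
Qed.

(* Main.v *)
From Stdlib Require Import Relation_Operators.
Require Import Defs.
From mathcomp Require Import all_boot zify.

Set Implicit Arguments.
Unset Strict Implicit.
Unset Printing Implicit Defensive.

(** Everything is read off the bracket vector of a tree S, the function f that
sends a vertex i to the largest label in the subtree rooted at i.

The vertices with the same value under f are those of a maximal chain of right
sons, whose last vertex is that common value.  In T_pi these chains are the
blocks of pi, so the bracket vector of T_pi sends i to the maximum of its block
([bracket_nc_tree], [fibres_block_max]).  A tree is determined by its bracket
vector ([bracket_inj]); hence pi |-> T_pi is a bijection from NC_n to Tam_n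
whose inverse sends S to the partition into the fibres of f
([nc_tree_fibres]).  As the bracket vector increases along the Tamari order
([bracket_tam_le]), that order is antisymmetric, an interval has only one pair
of ends, and the existence of pi1 <= pi2 becomes: the fibres of f refine
those of g, where f and g are the bracket vectors of S and T.

The relations of a tree are also visible on its bracket vector.  For i < j, the
decreasing relation j <| i says j <= f i, and the increasing relation i <| j
says that f x < j for all x in [i, j).  So the interval-poset of [S, T] is
described by f and g, which satisfy f <= g, and it remains to compare its
covers with the refinement ([exceptional_refinement]).

If the fibres refine and y is covered by both x < y and z > y, then f x < z, as
otherwise z <| x and y <| x is not a cover.  Hence y <= f x < z, and y <| z
gives g (f x) < z.  By refinement g x = g (f x) < z, which puts x below z, and
y <| z is not a cover.

If the fibres do not refine, some x and its right son y in S satisfy g y < g x.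
Then y <| x is a cover because y is the right son of x, and y is also covered
by the label g y + 1: this is the vertex of T that has in its left subtree the
right chain through y. *)

(** * Bracket vectors *)

Fixpoint bracket (S : bintree) (i : nat) : nat :=
  if S is Node l r then
    let k := bsize l in
    if i < k then bracket l i
    else if i == k then k + bsize r
    else k.+1 + bracket r (i - k.+1)
  else 0.

(** These conditions characterize the bracket vectors of trees of size n: the
segments [i, f i] are nested or disjoint. *)
Definition bracketing (n : nat) (f : nat -> nat) : Prop :=
  forall i, i < n -> i <= f i < n /\ forall j, i <= j <= f i -> f j <= f i.

Lemma bracketP S : bracketing (bsize S) (bracket S).
Proof.
elim: S => [|l IHl r IHr] //= i lt_i; split.
  have := IHl i; have := IHr (i - (bsize l).+1).
  case: ifP => [_|?] Hr Hl; first by case: Hl; lia.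
  by case: eqP => ?; [lia | case: Hr; lia].
move=> j; case: (ltnP i (bsize l)) => [lt_il|le_li].
  have [Hi Hj] := IHl _ lt_il; move=> Hij; have -> : j < bsize l by lia.
  exact: Hj.
case: eqP => [->|ne].
  move=> Hj; have -> : j < bsize l = false by lia.
  case: eqP => [|ne]; first by lia.
  have /IHr[] : j - (bsize l).+1 < bsize r by lia.
  by lia.
have /IHr[Hi Hj] : i - (bsize l).+1 < bsize r by lia.
move=> Hij; have -> : j < bsize l = false by lia.
have -> : j == bsize l = false by lia.
by have := Hj (j - (bsize l).+1); lia.
Qed.









Lemma lhd_lt S i j : lhd S i j -> i < bsize S.
Proof.
elim: S i j => [|l IHl r IHr] //= i j.
case: ifP => _; first by move/IHl; lia.
by case: ifP => // _ /andP[? /IHr]; lia.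
Qed.

(** For j < i, the vertex i can only lie in the right part of the subtree at j,
whose labels run from j to its bracket. *)
Lemma lhd_decreasing S i j :
  j < i -> i < bsize S -> lhd S i j = (i <= bracket S j).
Proof.
elim: S i j => [|l IHl r IHr] //= i j lt_ji lt_i.
case: ifP => [lt_j|ge_j].
  case: (ltnP i (bsize l)) => [lt_il|le_li]; first exact: IHl.
  have [? _] := bracketP lt_j.
  have : lhd l i j -> i < bsize l by exact: lhd_lt.
  by case: lhd; lia.
case: eqP => ?; first by lia.
by rewrite IHr; lia.
Qed.

(** Let x be the lowest common ancestor of i < j, so that i <= x <= j.  If
x = j, no subtree rooted in [i, j) contains a label >= j; if x < j, then j lies
in the right subtree of x, whose bracket is therefore >= j. *)
Lemma lhd_increasing S i j : i < j -> j < bsize S ->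
  lhd S i j <-> (forall x, i <= x < j -> bracket S x < j).
Proof.
elim: S i j => [|l IHl r IHr] //= i j lt_ij lt_j.
case: ifP => [lt_jl|ge_j].
  rewrite IHl //; split=> H x Hx; have := H x Hx.
    by have -> : x < bsize l by lia.
  by have -> : x < bsize l by lia.
case: eqP => [eq_j|ne].
  split=> [_ x|_]; last by lia.
  move=> Hx; have lt_x : x < bsize l by lia.
  by rewrite lt_x; have [] := bracketP lt_x; lia.
have lt_jr : j - (bsize l).+1 < bsize r by lia.
split=> [/andP[lt_i]|H].
  move/IHr => H x Hx; have := H ltac:(lia) lt_jr (x - (bsize l).+1).
  have -> : x < bsize l = false by lia.
  have -> : x == bsize l = false by lia.
  by lia.
have lt_i : bsize l < i.
  have := H (bsize l); rewrite ltnn eqxx; lia.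
rewrite lt_i; apply/IHr => //; first by lia.
move=> x Hx; have := H ((bsize l).+1 + x).
have -> : (bsize l).+1 + x < bsize l = false by lia.
have -> : (bsize l).+1 + x == bsize l = false by lia.
by rewrite addKn; lia.
Qed.

(** A rotation enlarges the subtree of the vertex between A and B, whose bracket
becomes that of the vertex between B and C, and fixes the other brackets. *)
Lemma bracket_cover S T i : tam_cover S T ->
  i < bsize S -> bracket S i <= bracket T i.
Proof.
move=> cST; elim: cST i => [A B C|l l' r cl IH|l r r' cr IH] i /=.
- move=> lt_i; case: (ltnP i (bsize A)) => ?.
    by have -> : i < (bsize A + bsize B).+1 by lia.
  case: (ltngtP i (bsize A + bsize B).+1) => ?.
  + case: eqP => ?; first by lia.
    by have -> : i - (bsize A).+1 < bsize B by lia.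
  + have -> : i == bsize A = false by lia.
    have -> : i - (bsize A).+1 < bsize B = false by lia.
    have -> : i - (bsize A).+1 == bsize B = false by lia.
    have -> : i - (bsize A).+1 - (bsize B).+1 = i - (bsize A + bsize B).+2.
      by lia.
    by lia.
  + have -> : i == bsize A = false by lia.
    have -> : i - (bsize A).+1 < bsize B = false by lia.
    have -> : i - (bsize A).+1 == bsize B by lia.
    by lia.
- rewrite -(bsize_tam_le (rt_step _ _ _ _ cl)) => lt_i.
  by case: ifP => // ?; apply: IH.
- rewrite -(bsize_tam_le (rt_step _ _ _ _ cr)) => lt_i.
  case: ifP => // ?; case: eqP => // ?; rewrite leq_add2l.
  by apply: IH; lia.
Qed.

Lemma bracket_tam_le S T : tam_le S T ->
  forall i, i < bsize S -> bracket S i <= bracket T i.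
Proof.
elim=> [{}S {}T cST i|//|A B C AB IHAB BC IHBC i lt_i].
  exact: bracket_cover.
by apply: leq_trans (IHAB i lt_i) (IHBC i _); rewrite -(bsize_tam_le AB).
Qed.

(** The root is the least vertex whose bracket is the last label. *)
Lemma bracket_inj S T : bsize S = bsize T ->
  (forall i, i < bsize S -> bracket S i = bracket T i) -> S = T.
Proof.
elim: S T => [|l IHl r IHr] [|l' r'] //= [Es] Eb.
have El : bsize l = bsize l'.
  have := Eb (bsize l); have := Eb (bsize l').
  rewrite !ltnn !eqxx.
  case: (ltngtP (bsize l) (bsize l')) => // lt_ll.
    by have [] := bracketP lt_ll; lia.
  by have [] := bracketP lt_ll; lia.
congr Node.
  apply: IHl => // i lt_i; have := Eb i; rewrite -El lt_i => -> //.
  by lia.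
apply: IHr => [|i lt_i]; first by lia.
have := Eb ((bsize l).+1 + i); rewrite -El.
have -> : (bsize l).+1 + i < bsize l = false by lia.
have -> : (bsize l).+1 + i == bsize l = false by lia.
by rewrite addKn; lia.
Qed.

(** * Antisymmetry of the Tamari order *)

Lemma tam_le_anti S T : tam_le S T -> tam_le T S -> S = T.
Proof.
move=> ST TS; have Es := bsize_tam_le ST; apply: bracket_inj => // i lt_i.
apply/eqP; rewrite eqn_leq bracket_tam_le //.
by rewrite (bracket_tam_le TS) // -Es.
Qed.

Lemma tam_interval_inj S T S' T' : tam_le S T ->
  (forall X, tam_interval S T X <-> tam_interval S' T' X) -> S = S' /\ T = T'.
Proof.
move=> ST E.
have [S'S ST'] : tam_interval S' T' S by apply/E; split=> //; exact: rt_refl.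
have [S'T TT'] : tam_interval S' T' T by apply/E; split=> //; exact: rt_refl.
have S'T' := rt_trans _ _ _ _ _ S'S ST'.
have [SS' _] : tam_interval S T S' by apply/E; split=> //; exact: rt_refl.
have [_ T'T] : tam_interval S T T' by apply/E; split=> //; exact: rt_refl.
by split; apply: tam_le_anti.
Qed.

(** * From a bracket vector to its noncrossing partition and its tree *)

Section Fibres.
Variables (n : nat) (f : nat -> nat).
Hypothesis fP : bracketing n f.

Definition fibres : {set {set 'I_n}} :=
  preim_partition (fun x : 'I_n => f x) setT.

Lemma bracketing_idem i : i < n -> f (f i) = f i.
Proof.
move=> lt_i; have [? H] := fP lt_i.
have [? _] := @fP (f i) ltac:(lia).
by have := H (f i); lia.
Qed.

Lemma fibresP (b : {set 'I_n}) :
  reflect (exists x : 'I_n, b = [set y : 'I_n | f y == f x]) (b \in fibres).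
Proof.
apply: (iffP imsetP) => [[x _ ->]|[x ->]]; exists x => //; apply/setP=> y;
by rewrite !inE eq_sym.
Qed.

Lemma fibre_max (b : {set 'I_n}) x :
  b \in fibres -> x \in b -> \max_(y in b) y.+1 = (f x).+1.
Proof.
case/fibresP=> z -> /[!inE] /eqP ->; apply/eqP; rewrite eqn_leq.
have [/andP[_ lt_fz] _] := fP (ltn_ord z).
apply/andP; split.
  apply/bigmax_leqP=> y /[!inE] /eqP <-.
  by have [/andP[]] := fP (ltn_ord y).
apply: (leq_bigmax_cond (F := fun y : 'I_n => y.+1) (Ordinal lt_fz)).
by rewrite inE /= bracketing_idem.
Qed.

(** If i < j < k < l, with i, k in one fibre and j, l in another, then
j <= f i and k <= f j force f i = f j by nesting. *)
Lemma NC_fibres : NC fibres.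
Proof.
split; first exact: preim_partitionP.
case=> b [b' [i [j [k [l [[/fibresP[x ->] /fibresP[y ->] ne]]]]]]].
rewrite !inE => -[[lt_ij lt_jk lt_kl] [/eqP Ei /eqP Ek /eqP Ej /eqP El]].
case/eqP: ne; apply/setP=> z; rewrite !inE; congr (_ == _).
have [_ Hi] := fP (ltn_ord i); have [_ Hj] := fP (ltn_ord j).
have [? _] := fP (ltn_ord k); have [? _] := fP (ltn_ord l).
by have := Hi j; have := Hj k; lia.
Qed.

(** The tree t, with its labels shifted to [o, m), has f as its bracket vector.
The shift is needed because in-order labels of a subtree start at 0. *)
Definition spans (t : bintree) (o m : nat) : Prop :=
  o + bsize t = m /\ forall i, i < bsize t -> f (o + i) = o + bracket t i.

Lemma spans_Node l r o q e : spans l o q -> spans r q.+1 e.+1 -> f q = e ->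
  spans (Node l r) o e.+1.
Proof.
move=> [sl Hl] [sr Hr] fq; split=> /= [|i lt_i]; first by lia.
case: ifP => ?; first exact: Hl.
case: eqP => ?; first by rewrite (_ : o + i = q) ?fq; lia.
have := Hr (i - (bsize l).+1).
have -> : q.+1 + (i - (bsize l).+1) = o + i by lia.
by lia.
Qed.

(** The tree t is the left subtree that the vertex m must have in the tree with
bracket vector f (the whole tree if m = n).  The vertices of that left subtree
form the longest segment [o, m) on which f stays below m. *)
Definition grafts_before (t : bintree) (m : nat) : Prop :=
  exists o, [/\ spans t o m, forall x, o <= x < m -> f x < m &
                0 < o -> m <= f o.-1].

(** The right subtree of p is the chain of its successors in its block.  The
grafts leave no gap: a vertex strictly between p and its successor q has its
bracket below q, because it lies under p and outside the block, so nesting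
forbids reaching q.  So the left subtree of q starts at p + 1. *)
Lemma spans_chain (L : 'I_n -> bintree) e s (p : 'I_n) :
  f p = e -> path ltn p (map val s) ->
  (forall x : 'I_n, p < x -> (x \in s) = (f x == e)) ->
  (forall x, x \in s -> grafts_before (L x) x) ->
  spans (foldr (fun x t => Node (L x) t) Leaf s) p.+1 e.+1.
Proof.
elim: s p => [|q s IH] p fp /= => [_|/andP[lt_pq ps]] Hs HL.
  (* With no successor left, p is the maximum e of its block. *)
  split=> //=; rewrite addn0; congr _.+1.
  have [/andP[le_p lt_fp] _] := fP (ltn_ord p).
  have := Hs (Ordinal lt_fp); rewrite in_nil /= bracketing_idem // fp eqxx.
  by lia.
have fq : f q = e by apply/eqP; rewrite -Hs // mem_head.
apply: spans_Node (fq); last first.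
  apply: IH => // x; last by move=> xs; apply: HL; rewrite inE xs orbT.
  move=> lt_qx; rewrite -Hs; last by lia.
  by rewrite inE; case: eqP => // Ex; move: lt_qx; rewrite Ex ltnn.
have [o [[so Ho] H1 H2]] := HL q (mem_head _ _).
suff <- : o = p.+1 by [].
have [? Hp] := fP (ltn_ord p); have [? _] := fP (ltn_ord q).
case: (ltngtP o p.+1) => // cmp; first by have := H1 p; lia.
(* Otherwise o - 1 would be an element of the block between p and q. *)
have lt_w : o.-1 < n by have := ltn_ord q; lia.
have [_ Hw] := fP lt_w.
have := Hs (Ordinal lt_w); rewrite /= inE.
have -> : f o.-1 == e by have := Hp o.-1; have := Hw q; lia.
case: eqP => [/(congr1 val) /=|_]; first by lia.
move=> ws; have := ws ltac:(lia) => {}ws.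
have : o.-1 \in map val s by apply/mapP; exists (Ordinal lt_w).
move: ps; rewrite path_sortedE; last exact: ltn_trans.
by case/andP=> /allP H _ /H; lia.
Qed.

Lemma sorted_enum (b : {set 'I_n}) : sorted ltn (map val (enum b)).
Proof.
rewrite sorted_map; apply: sorted_filter.
  by move=> ? ? ? /=; exact: ltn_trans.
by rewrite -sorted_map -enumT val_enum_ord iota_ltn_sorted.
Qed.

(** By strong induction on m.  If m - 1 is the maximum of a block with minimum
q, the segment found for q is also maximal for m: a vertex just before it has a
bracket >= q, and would by nesting belong to the block if that bracket were
below m.  If m - 1 is not a maximum, its own bracket is >= m and the segment is
empty. *)
Lemma grafts_before_graft m : m <= n -> grafts_before (graft fibres m m) m.
Proof.
elim/ltn_ind: m => -[|e] IH le_m.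
  by exists 0; split=> //; split=> // i; rewrite ltn0.
rewrite /=; case: pickP => [b /andP[bF /eqP maxb]|none]; last first.
  exists e.+1; split=> [|x|_]; [split=> //=; lia | lia |].
  have [/andP[le_e lt_fe] _] := fP le_m.
  rewrite ltn_neqAle le_e andbT /=; apply/eqP=> Ee.
  pose x := Ordinal le_m; pose b := [set y : 'I_n | f y == f x].
  have bF : b \in fibres by apply/fibresP; exists x.
  by have := none b; rewrite bF /= (@fibre_max b x) ?inE //= -Ee eqxx.
have inb (x : 'I_n) : (x \in b) = (f x == e).
  apply/idP/eqP => [xb|fx].
    by have := fibre_max bF xb; rewrite maxb => -[].
  have /fibresP[z Eb] := bF.
  have zb : z \in b by rewrite Eb inE.
  by have := fibre_max bF zb; rewrite maxb Eb inE fx => -[->].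
have le_f x : x < n -> x <= f x by move=> lt_x; have [/andP[]] := fP lt_x.
rewrite /block_tree; case Es: (enum b) => [|q s] /=.
  have /fibresP[z Eb] := bF.
  have : z \in enum b by rewrite mem_enum Eb inE.
  by rewrite Es in_nil.
have mem_s x : (x \in q :: s) = (f x == e) by rewrite -Es mem_enum inb.
have fq : f q = e by apply/eqP; rewrite -mem_s mem_head.
have := sorted_enum b; rewrite Es /= => ps.
have := ps; rewrite path_sortedE; last exact: ltn_trans.
case/andP=> /allP lt_qs _.
have Lx (x : 'I_n) : x \in q :: s -> grafts_before (graft fibres e x) x.
  rewrite mem_s => /eqP fx; have := le_f x (ltn_ord x); rewrite fx => le_xe.
  rewrite graft_fuel //; first by apply: IH => //; lia.
  apply/fibresP=> -[z /setP/(_ z)]; by rewrite !inE eqxx.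
have [o [so H1 H2]] := Lx q (mem_head _ _).
have [? Hq] := fP (ltn_ord q).
exists o; split=> [|x /andP[le_ox]|o_gt0].
- apply: (spans_Node so _ fq); apply: (spans_chain fq) => // x.
    by rewrite -mem_s inE; case: eqP => // ->; rewrite ltnn.
  by move=> xs; apply: Lx; rewrite inE xs orbT.
- case: (ltnP x q) => [lt_xq _|le_qx lt_xe]; first by have := H1 x; lia.
  by have := Hq x; lia.
- have := so; case=> so1 _.
  have lt_w : o.-1 < n by have := ltn_ord q; lia.
  have [_ Hw] := fP lt_w.
  have := H2 o_gt0 => le_q; rewrite ltnNge; apply/negP=> le_e.
  have Ew : f o.-1 = e by have := Hw q; lia.
  have := mem_s (Ordinal lt_w); rewrite /= Ew eqxx inE.
  case/orP=> [/eqP/(congr1 val) /=|ws]; first by lia.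
  have : o.-1 \in map val s by apply/mapP; exists (Ordinal lt_w).
  by move/lt_qs; lia.
Qed.

Lemma bracket_nc_tree :
  bsize (nc_tree fibres) = n /\
  forall i, i < n -> bracket (nc_tree fibres) i = f i.
Proof.
have [o [[so Hf] _ Ho]] := grafts_before_graft (leqnn n).
have o0 : o = 0.
  case: (posnP o) => // o_gt0; have lt_w : o.-1 < n by lia.
  by have [] := fP lt_w; have := Ho o_gt0; lia.
move: so Hf; rewrite o0 add0n -/(nc_tree _) => -> Hf; split=> // i lt_i.
by have := Hf i lt_i; rewrite !add0n.
Qed.
End Fibres.

Lemma nc_tree_fibres n S : bsize S = n -> nc_tree (fibres n (bracket S)) = S.
Proof.
move=> hS; have bS : bracketing n (bracket S) by rewrite -hS; exact: bracketP.
have [E1 E2] := bracket_nc_tree bS.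
by apply: bracket_inj => [|i]; rewrite E1 ?hS // => /E2.
Qed.

(** * From a noncrossing partition to a bracket vector *)

Section BlockMax.
Variables (n : nat) (pi : {set {set 'I_n}}).
Hypothesis piNC : NC pi.

Definition block_max (i : nat) : nat :=
  if insub i is Some x then \max_(y in pblock pi x) (y : nat) else 0.

Lemma mem_own_block x : x \in pblock pi x.
Proof. by rewrite mem_pblock (cover_partition piNC.1) inE. Qed.

Lemma block_maxP (x : 'I_n) : exists y : 'I_n,
  [/\ y \in pblock pi x, block_max x = y &
      forall z : 'I_n, z \in pblock pi x -> z <= y].
Proof.
rewrite /block_max valK.
have [|y yb Ey] :=
  @eq_bigmax_cond _ (mem (pblock pi x)) (fun y : 'I_n => y : nat).
  by apply/card_gt0P; exists x; exact: mem_own_block.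
exists y; split=> // z zb.
by rewrite -Ey; apply: (leq_bigmax_cond (F := fun y : 'I_n => y : nat)).
Qed.

Lemma same_block x y : y \in pblock pi x -> pblock pi y = pblock pi x.
Proof. by have /and3P[_ tI _] := piNC.1; exact: same_pblock. Qed.

Lemma block_max_eq (x y : 'I_n) :
  (block_max x == block_max y) = (y \in pblock pi x).
Proof.
apply/eqP/idP=> [|/same_block]; last by rewrite /block_max !valK => ->.
have [x' [/same_block <- -> _]] := block_maxP x.
have [y' [/same_block Ey -> _]] := block_maxP y.
by move/val_inj=> ->; rewrite Ey mem_own_block.
Qed.

(** Noncrossing is used for nesting: if x < y < max of the block of x and the
block of y reached further, the four vertices would cross. *)
Lemma block_max_bracketing : bracketing n block_max.
Proof.
move=> i lt_i; pose x := Ordinal lt_i; rewrite -[i]/(val x).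
have [x' [bx' Ex lex]] := block_maxP x.
rewrite Ex ltn_ord andbT; split; first exact/lex/mem_own_block.
move=> j /andP[le_xj le_jx']; have lt_j := leq_ltn_trans le_jx' (ltn_ord x').
pose y := Ordinal lt_j; rewrite -[j]/(val y).
have [yx|ynx] := boolP (y \in pblock pi x).
  by move: (yx); rewrite -block_max_eq => /eqP <-; rewrite Ex.
have [y' [by' -> ley]] := block_maxP y; rewrite leqNgt; apply/negP=> lt_xy'.
case: piNC => /and3P[_ tI _]; case.
exists (pblock pi x), (pblock pi y), x, y, x', y'; split.
  split; rewrite ?pblock_mem ?(cover_partition piNC.1) //.
  by apply: contraNneq ynx => ->; exact: mem_own_block.
split; last by rewrite !mem_own_block.
split=> //.
  rewrite ltn_neqAle le_xj andbT; apply: contraNneq ynx => Exy.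
  by rewrite -(_ : x = y) ?mem_own_block //; exact: val_inj.
rewrite ltn_neqAle le_jx' andbT; apply: contraNneq ynx => Exy.
by rewrite (_ : y = x') //; exact: val_inj.
Qed.

Lemma fibres_block_max : fibres n block_max = pi.
Proof.
rewrite -[RHS](preim_partition_pblock piNC.1); apply: eq_imset => x.
apply/setP=> y; rewrite !inE block_max_eq; apply/idP/eqP => [/same_block //|->].
exact: mem_own_block.
Qed.

End BlockMax.

Lemma nc_le_fibres n f g :
  nc_le (fibres n f) (fibres n g) <->
  forall x y : 'I_n, f x = f y -> g x = g y.
Proof.
split=> [le_fg x y Exy|H _ /fibresP[x ->]].
  have [|_ /fibresP[z ->] /subsetP sub] := le_fg [set y : 'I_n | f y == f x].
    by apply/fibresP; exists x.
  have := sub x; have := sub y; rewrite !inE Exy eqxx.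
  by move=> /(_ isT) /eqP -> /(_ isT) /eqP.
exists [set y : 'I_n | g y == g x]; first by apply/fibresP; exists x.
by apply/subsetP=> y /[!inE] /eqP /H ->.
Qed.

(** * Exceptional interval-posets *)

(** The relation r is the interval-poset of a pair of trees whose bracket
vectors are f, for the decreasing relations, and g, for the increasing ones. *)
Definition bracket_rel (n : nat) (f g : nat -> nat) (r : rel 'I_n) : Prop :=
  forall i j : 'I_n, [/\ i < j -> r j i = (j <= f i)
    & i < j -> r i j <-> forall x, i <= x < j -> g x < j].

Lemma interval_posetP n S T : bsize S = n -> bsize T = n ->
  bracket_rel (bracket S) (bracket T) (interval_poset (n := n) S T).
Proof.
move=> hS hT i j; split=> lt_ij; rewrite /interval_poset.
  rewrite -val_eqE /= lt_ij gtn_eqF // ltnNge (ltnW lt_ij) /= orbF.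
  by rewrite lhd_decreasing // hS.
rewrite -val_eqE /= lt_ij ltn_eqF // ltnNge (ltnW lt_ij) /=.
by apply: lhd_increasing => //; rewrite hT.
Qed.

(** If x and its right son y in the lower tree lie on different right chains of
the upper tree, then in the latter y lies in the left subtree of some vertex z
below x; the nearest such z covers y, as x does.  Conversely, vertices x < y < z
such that x and z both cover y force g y < z <= g x, and the right chain of x in
the lower tree ends in [y, z), so it is cut between x and its end. *)
Lemma exceptional_refinement n f g (r : rel 'I_n) :
  bracketing n f -> bracketing n g -> (forall i, i < n -> f i <= g i) ->
  bracket_rel f g r ->
  (forall x y : 'I_n, f x = f y -> g x = g y) <-> exceptional r.
Proof.
move=> fP gP le_fg rP.
have dec (i j : 'I_n) : i < j -> r j i = (j <= f i) by have [] := rP i j.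
have inc (i j : 'I_n) : i < j -> r i j <-> forall x, i <= x < j -> g x < j.
  by have [] := rP i j.
have ord_neq (i j : 'I_n) : i != j = (i != j :> nat) by rewrite -val_eqE.
split=> [ref [x [y [z [lt_xy lt_yz]]]]|exc].
  rewrite /covered_by => /and3P[_ ryx /existsPn /(_ z) covx].
  case/and3P=> _ ryz /existsPn /(_ x) covz.
  move: (ryx); rewrite dec // => le_yx.
  have {}covx : f x < z.
    rewrite ltnNge -dec; last by lia.
    by move: covx; rewrite !ord_neq ryz; case: (r z x) => //; lia.
  have [/andP[_ lt_fx] _] := fP x (ltn_ord x).
  have gfx : g x = g (f x).
    by apply: (ref x (Ordinal lt_fx)); rewrite /= (bracketing_idem fP).
  have /(inc _ _ lt_yz) Hz := ryz.
  have lt_gx : g x < z by rewrite gfx; apply: Hz; rewrite le_yx.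
  have rxz : r x z.
    apply/inc => [|w /andP[le_xw lt_wz]]; first by lia.
    case: (leqP y w) => [le_yw|lt_wy]; first by apply: Hz; rewrite le_yw.
    have [_ /(_ w) Hx] := gP x (ltn_ord x).
    by have := le_fg x (ltn_ord x); lia.
  by move: covz; rewrite !ord_neq ryx rxz; lia.
(* The induction bounds f x - x, so the claim is known for the elements of the
   fibre of x that lie beyond x. *)
suff main : forall k (x : 'I_n), f x <= x + k -> g x = g (f x).
  move=> x y Exy; rewrite (main n x); last first.
    by have [] := fP x (ltn_ord x); lia.
  by rewrite Exy -(main n) //; have [] := fP y (ltn_ord y); lia.
elim=> [|k IH] x le_k; have [Hx1 Hx2] := fP x (ltn_ord x).
  by have -> : f x = x by lia.
case: (ltngtP x (f x)) => [lt_x||<-] //; last by lia.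
have lt_fx : f x < n by lia.
(* The right son of x in the lower tree. *)
have [y lt_xy ymin] : exists2 y : 'I_n, x < y /\ f y = f x &
    forall w : 'I_n, x < w -> f w = f x -> y <= w.
  have [|y /andP[? /eqP ?] ymin] := @arg_minnP _ (Ordinal lt_fx)
    (fun y : 'I_n => (x < y) && (f y == f x)) (fun y : 'I_n => y : nat).
    by rewrite /= lt_x (bracketing_idem fP) /=.
  by exists y => // w ltw Ew; apply: ymin; rewrite ltw Ew eqxx.
case: lt_xy => lt_xy Ey.
have gy : g y = g (f x) by rewrite -Ey; apply: IH; lia.
case: (eqVneq (g x) (g (f x))) => // ne; case: exc.
have [Gx1 Gx2] := gP x (ltn_ord x); have [Gy1 Gy2] := gP y (ltn_ord y).
have [Fy1 Fy2] := fP y (ltn_ord y).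
have le_fgx := le_fg x (ltn_ord x); have le_fgy := le_fg y (ltn_ord y).
have lt_g : g y < g x.
  by rewrite gy ltn_neqAle eq_sym ne Gx2 //; lia.
have lt_z : (g y).+1 < n by lia.
(* The vertex of the upper tree with the right chain through y on its left. *)
pose z := Ordinal lt_z.
have ryz : r y z by apply/inc => [/=|w /= Hw]; [lia | have := Gy2 w; lia].
have ryx : r y x by rewrite dec //; lia.
(* By nesting, w would belong to the fibre of x, whose first element after x
   is y. *)
have gap (w : 'I_n) : x < w -> w < y -> y <= f w -> False.
  move=> lt_xw lt_wy le_y; have [Fw1 Fw2] := fP w (ltn_ord w).
  have := ymin w lt_xw; have := Hx2 w; have := Fw2 y; lia.
exists x, y, z; split=> //; first by rewrite /=; lia.
  rewrite /covered_by ryx ord_neq /=; apply/andP; split; first by lia.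
  apply/existsPn=> w; rewrite !ord_neq; apply/negP=> /and4P[ne1 ne2 ryw rwx].
  have lt_w := ltn_ord w.
  case: (ltngtP w y) => [lt_wy|lt_yw|]; last by lia.
    move: ryw; rewrite dec // => ryw.
    case: (ltngtP w x) => [lt_wx||]; last by lia.
      move/(inc _ _ lt_wx): rwx => /(_ w); have := le_fg w lt_w; lia.
    by move=> lt_xw; apply: (gap w).
  move: rwx; rewrite dec => [rwx|]; last by lia.
  move/(inc _ _ lt_yw): ryw => /(_ y); lia.
rewrite /covered_by ryz ord_neq /=; apply/andP; split; first by lia.
apply/existsPn=> w; rewrite !ord_neq /=; apply/negP=> /and4P[ne1 ne2 ryw rwz].
have lt_w := ltn_ord w.
case: (ltngtP w y) => [lt_wy|lt_yw|]; last by lia.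
  move: ryw; rewrite dec // => ryw.
  have lt_wz : w < z by rewrite /=; lia.
  move/(inc _ _ lt_wz): rwz => /(_ x) /=.
  case: (ltnP x w) => [lt_xw _|]; [exact: (gap w) | lia].
move/(inc _ _ lt_yw): ryw => ryw.
case: (ltngtP w z) => /= [lt_wz|lt_zw|]; [| |lia].
  by have := ryw y; lia.
move: rwz; rewrite dec // => le_w; have := ryw z; rewrite /=.
by have := le_fg z lt_z; rewrite /= in le_w *; lia.
Qed.

Theorem theorem3p11 (n : nat) (S T : bintree)
    (hS : bsize S = n) (hT : bsize T = n) (hST : tam_le S T) :
  (exists pi1 pi2 : {set {set 'I_n}},
     [/\ NC pi1, NC pi2, nc_le pi1 pi2 &
         forall X : bintree,
           tam_interval S T X <->
           tam_interval (nc_tree pi1) (nc_tree pi2) X])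
  <-> exceptional (interval_poset (n := n) S T).
Proof.
have bS : bracketing n (bracket S) by rewrite -hS; exact: bracketP.
have bT : bracketing n (bracket T) by rewrite -hT; exact: bracketP.
have le_ST i : i < n -> bracket S i <= bracket T i.
  by rewrite -hS; exact: bracket_tam_le.
rewrite -(exceptional_refinement bS bT le_ST (interval_posetP hS hT)).
rewrite -nc_le_fibres; split=> [[pi1 [pi2 [NC1 NC2 le12 E]]]|le12].
  have [-> ->] := tam_interval_inj hST E.
  suff fib pi : NC pi -> fibres n (bracket (nc_tree pi)) = pi by rewrite !fib.
  move=> piNC; rewrite -[RHS](fibres_block_max piNC).
  have [_ Eb] := bracket_nc_tree (block_max_bracketing piNC).
  rewrite fibres_block_max // in Eb.
  apply: eq_imset => x; apply/setP=> y; rewrite !inE.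
  by rewrite !Eb.
exists (fibres n (bracket S)), (fibres n (bracket T)).
by split=> // [||X]; rewrite ?nc_tree_fibres //; exact: NC_fibres.
Qed.
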